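(* For every integer $d\ge 7$, the line arrangement $\mathcal B_d$ in $\mathbb P^2$ defined as follows satisfies $r(\mathcal B_d)=d-3$. For $d=2p$ even, $\mathcal B_{2p}$ is defined by $$xy\prod_{j=1}^{p-1}\Big(\frac{x}{2^j}+\frac{y}{3^j}-z\Big)\Big(\frac{x}{2^j}+\frac{y}{3^{j+1}}-z\Big)=0,$$ and for $d=2p+1$ odd, $\mathcal B_{2p+1}$ is defined by $$xy\Big(\frac{x}{2^p}+\frac{y}{3^p}-z\Big)\prod_{j=1}^{p-1}\Big(\frac{x}{2^j}+\frac{y}{3^j}-z\Big)\Big(\frac{x}{2^j}+\frac{y}{3^{j+1}}-z\Big)=0.$$
   Context: $\mathbb K$ is a field of characteristic zero and $S=\mathbb K[x,y,z]$ with the standard grading. For a line arrangement $\mathcal A:f=0$ in $\mathbb P^2$ ($f\in S$ a product of pairwise non-proportional linear forms), $r(\mathcal A)$ is the minimal degree $r$ for which there is a nonzero triple $(a,b,c)\in S_r^3$ with $af_x+bf_y+cf_z=0$. The index $d$ of $\mathcal B_d$ is its number of lines. *)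

(* Defs.v *)
From mathcomp Require Import all_boot all_order all_algebra.
From mathcomp Require Export mpoly.

Set Implicit Arguments.
Unset Strict Implicit.
Unset Printing Implicit Defensive.

Import GRing.Theory.
Local Open Scope ring_scope.

Section LineArrangements.

Variable K : fieldType.

Local Notation S := {mpoly K[3]}.

Definition ord3_0 : 'I_3 := @Ordinal 3 0 isT.
Definition ord3_1 : 'I_3 := @Ordinal 3 1 isT.
Definition ord3_2 : 'I_3 := @Ordinal 3 2 isT.

Definition vx : S := 'X_ord3_0.
Definition vy : S := 'X_ord3_1.
Definition vz : S := 'X_ord3_2.

(* The zero polynomial is 1.-homog, so nonvanishing is stated separately;
   non-proportionality is required for both orders of each pair of indices. *)
Definition line_arrangement (d : nat) (f : S) : Prop :=
  exists l : 'I_d -> S,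
    [/\ forall i, l i \is 1.-homog /\ l i != 0,
        forall i j, i != j -> forall c : K, l i != c *: l j
      & f = \prod_(i < d) l i].

(* The component 0 of a syzygy has every degree, as in the graded piece S_r. *)
Definition has_jacobian_syzygy (f : S) (r : nat) : Prop :=
  exists a b c : S,
    [/\ [/\ a \is r.-homog, b \is r.-homog & c \is r.-homog],
        (a, b, c) != (0, 0, 0)
      & a * f^`M(ord3_0) + b * f^`M(ord3_1) + c * f^`M(ord3_2) = 0].

(* [is_mdr f r] says r(A) = r for the arrangement A : f = 0. *)
Definition is_mdr (f : S) (r : nat) : Prop :=
  has_jacobian_syzygy f r /\ forall s, has_jacobian_syzygy f s -> (r <= s)%N.

Definition Bline (i j : nat) : S := (2 ^- i) *: vx + (3 ^- j) *: vy - vz.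

Definition B_even (p : nat) : S :=
  vx * vy * \prod_(1 <= j < p) (Bline j j * Bline j j.+1).

Definition B_odd (p : nat) : S :=
  vx * vy * Bline p p * \prod_(1 <= j < p) (Bline j j * Bline j j.+1).

Definition B (d : nat) : S := if odd d then B_odd d./2 else B_even d./2.

End LineArrangements.

(* Main.v *)
Require Import Defs.
From mathcomp Require Import all_boot all_order all_algebra.
From mathcomp Require Import mpoly.
From mathcomp Require Import ring zify.

Import GRing.Theory.
Local Open Scope ring_scope.

(** Put x = 1.  The lines of the arrangement other than x = 0 and y = 0 become
    the graphs z = a_k + b_k y, with a_k = 2^-(k/2+1) and b_k = 3^-((k+1)/2+1)
    for k < n = d - 2; each of them meets its predecessor on one of the two
    coordinate axes (the zigzag).

    Lower bound.  A syzygy (u, v, w) of degree s is a derivation killing the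
    equation f, hence tangent to every line.  Subtracting the multiple of the
    Euler derivation that cancels its first component leaves a vector field
    p d/dy + q d/dz of the affine plane; since x divides u, both p and q have
    degree at most s.  The field is tangent to y = 0, so p vanishes there, and
    to the n graphs.  If s <= n - 2 such a field is zero ([tangent_eq0]): on the
    last graph, p vanishes at y = 0 and at the points where the n - 2 graphs
    other than the predecessor cross it.  These n - 1 points are distinct, while
    the restriction of p has degree at most n - 2, so p, and then q, vanish on
    the last graph.  Dividing both by its equation lowers the degree and the
    number of graphs by one.  Therefore (u, v, w) is a multiple of the Euler
    derivation, which multiplies f by its degree, so it is zero.

    The points are distinct because, beyond the forced concurrences on the axes,
    no line passes through an intersection point of two earlier ones.  This
    amounts to (2^m - 1)(3^n' - 1) <> (2^m' - 1)(3^n - 1) for the exponents that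
    occur: two earlier lines of different kinds (indices of different parity)
    are separated by congruences modulo 3 and 4 ([cross_parity]), and two of the
    same kind by the monotonicity of (3^n - 1) / (2^m - 1) along m - n constant
    ([cross_mono]).

    Upper bound.  The lines y, L_0, L_1 meet in the point (2 : 0 : 1).  Write
    f = g h with g the product of these three; the constant derivation D in the
    direction of the point kills g, and d h D - D(h) E, with E the Euler
    derivation, is a syzygy of degree deg h = d - 3 ([zigzag_syzygy]). *)

Set Implicit Arguments.
Unset Strict Implicit.
Unset Printing Implicit Defensive.

(** * Cross ratios of powers of two and three *)

Lemma pow2_subn1_mod3 m : ((2 ^ m - 1) %% 3)%N = odd m.
Proof.
elim: m => // m IH; rewrite expnS /=.
have := expn_gt0 2 m; lia.
Qed.

Lemma pow3_subn1_mod4 n : ((3 ^ n - 1) %% 4)%N = (odd n).*2.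
Proof.
elim: n => // n IH; rewrite expnS /=.
have := expn_gt0 3 n; lia.
Qed.

Lemma pow3_subn1_mod3 n : (0 < n)%N -> ((3 ^ n - 1) %% 3)%N = 2%N.
Proof.
case: n => // n _; rewrite expnS.
have := expn_gt0 3 n; lia.
Qed.

Lemma pow2_subn1_mod2 m : (0 < m)%N -> ((2 ^ m - 1) %% 2)%N = 1%N.
Proof.
case: m => // m _; rewrite expnS.
have := expn_gt0 2 m; lia.
Qed.

(** Modulo 3 each factor 3^n - 1 is 2, and 2^m - 1 is 0 or 1 with the parity of
    m; modulo 4 each factor 2^m - 1 is odd, and 3^n - 1 is 0 or 2 with the parity
    of n. *)
Lemma cross_parity m n m' n' : (0 < m)%N -> (0 < n)%N -> (0 < m')%N -> (0 < n')%N ->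
  ((2 ^ m - 1) * (3 ^ n' - 1) = (2 ^ m' - 1) * (3 ^ n - 1))%N ->
  odd m = odd m' /\ odd n = odd n'.
Proof.
move=> m0 n0 m'0 n'0.
have a1 := pow2_subn1_mod3 m; have a2 := pow2_subn1_mod3 m'.
have b1 := pow3_subn1_mod3 n0; have b2 := pow3_subn1_mod3 n'0.
have c1 := pow2_subn1_mod2 m0; have c2 := pow2_subn1_mod2 m'0.
have d1 := pow3_subn1_mod4 n; have d2 := pow3_subn1_mod4 n'.
move: (2 ^ m - 1)%N (2 ^ m' - 1)%N (3 ^ n - 1)%N (3 ^ n' - 1)%N
  a1 a2 b1 b2 c1 c2 d1 d2.
move=> A A' B B' a1 a2 b1 b2 c1 c2 d1 d2 E.
split.
  have /(congr1 (modn^~ 3)) := E.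
  rewrite -modnMml -modnMmr a1 b2 -[RHS]modnMml -[in RHS]modnMmr a2 b1.
  by case: (odd m) (odd m') => -[].
have /(congr1 (modn^~ 4)) := E.
rewrite -modnMmr d2 -[RHS]modnMmr d1.
case: (odd n) (odd n') => -[] //=; lia.
Qed.

(** The ratio (3^n - 1) / (2^m - 1) grows when m and n are raised by the same
    amount: (2^(m+t) - 1) / (2^m - 1) is largest at m = 1, where it is
    2^(t+1) - 1 <= 3^t, while (3^(n+t) - 1) / (3^n - 1) > 3^t for n > 0. *)
Lemma cross_mono m n t : (0 < m)%N -> (0 < t)%N ->
  ((2 ^ (m + t) - 1) * (3 ^ n - 1) < (2 ^ m - 1) * (3 ^ (n + t) - 1))%N.
Proof.
move=> m0 t0.
have t_bound : (2 * 2 ^ t <= 3 ^ t + 1)%N.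
  elim: t t0 => // -[|t] IH _ //.
  by rewrite !(expnS _ t.+1); have := IH isT; lia.
have A2 : (2 <= 2 ^ m)%N by rewrite -[X in (X <= _)%N]expn1 leq_exp2l.
have T2 : (2 <= 2 ^ t)%N by rewrite -[X in (X <= _)%N]expn1 leq_exp2l.
have B1 := expn_gt0 3 n.
rewrite !expnD.
move: (2 ^ m)%N (2 ^ t)%N (3 ^ n)%N (3 ^ t)%N A2 T2 B1 t_bound => A T B U A2 T2 B1 TU.
have key : (A * T - 1 <= (A - 1) * U)%N.
  have : ((A - 1) * (2 * T - 1) <= (A - 1) * U)%N by rewrite leq_mul2l; lia.
  case: A A2 => [|[|a]] // _; case: T T2 {TU} => [|[|c]] // _; nia.
apply: (@leq_ltn_trans ((A - 1) * (U * (B - 1)))); first by rewrite mulnA leq_mul2r key orbT.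
rewrite ltn_pmul2l; last by lia.
rewrite mulnBr muln1 [(U * B)%N]mulnC.
have : (U <= B * U)%N by rewrite leq_pmull.
lia.
Qed.

(** * Vector fields tangent to lines of the affine plane *)

Section Descent.
Variable K : fieldType.
Implicit Types (p q : {poly {poly K}}) (l : {poly K}).

(** Total degree less than [k], for a polynomial in z with coefficients in K[y].
    The truncated subtraction makes the coefficients of z^i vanish for i >= k,
    so that [tdeg_lt 0] characterizes the zero polynomial. *)
Definition tdeg_lt k p := forall i, (size (p`_i)%R <= k - i)%N.

Lemma tdeg_lt0 p : tdeg_lt 0 p -> p = 0.
Proof.
move=> h; apply/polyP=> i; rewrite coef0.
by apply/eqP; rewrite -size_poly_leq0; have := h i; rewrite sub0n.
Qed.

Lemma tdeg_lt_horner k p l : tdeg_lt k p -> (size l <= 2)%N -> (size (p.[l])%R <= k)%N.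
Proof.
move=> hp hl; rewrite horner_coef; apply: (leq_trans (size_sum _ _ _)).
apply/bigmax_leqP=> i _.
have [ki|ik] := leqP k i.
  have := hp i; rewrite (eqP (ki : k - i == 0)%N) leqn0 size_poly_eq0 => /eqP ->.
  by rewrite mul0r size_poly0.
apply: (leq_trans (size_polyMleq _ _)).
have := hp i; have := size_poly_exp_leq l i.
have : ((size l).-1 * i <= i)%N by rewrite -[leqRHS]mul1n leq_mul2r; lia.
by move: (size (l ^+ i)) (size (p`_i)) => u v; lia.
Qed.

(** The coefficients of the quotient are obtained from the top one downwards by
    p_i = (p (z - l))_(i+1) + l p_(i+1), and [l] has degree at most one. *)
Lemma tdeg_lt_factor k p l : (size l <= 2)%N ->
  tdeg_lt k.+1 (p * ('X - l%:P)) -> tdeg_lt k p.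
Proof.
move=> hl hp.
have rec i : p`_i = (p * ('X - l%:P))`_i.+1 + p`_i.+1 * l.
  by rewrite mulrBr coefB coefMX coefMC /= subrK.
suff : forall n i, (size p - i <= n)%N -> (size (p`_i)%R <= k - i)%N.
  by move=> h i; apply: (h (size p)); apply: leq_subr.
elim=> [|n IH] i hi.
  by rewrite nth_default ?size_poly0 // -subn_eq0 -leqn0.
have IH1 := IH i.+1 ltac:(lia).
rewrite rec; apply: (leq_trans (size_polyD _ _)); rewrite geq_max; apply/andP; split.
  by have := hp i.+1; rewrite subSS.
have [E|nz] := eqVneq p`_i.+1 0; first by rewrite E mul0r size_poly0.
apply: (leq_trans (size_polyMleq _ _)).
by move: nz; rewrite -size_poly_gt0; lia.
Qed.

Variables a b : nat -> K.

Definition aff_line k : {poly K} := (a k)%:P + b k *: 'X.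

Lemma size_aff_line k : (size (aff_line k) <= 2)%N.
Proof.
apply: (leq_trans (size_polyD _ _)); rewrite geq_max.
rewrite (leq_trans (size_polyC_leq1 _)) //=.
by apply: (leq_trans (size_scale_leq _ _)); rewrite size_polyX.
Qed.

Hypothesis line_inj : forall i n, (i < n)%N -> aff_line i != aff_line n.
Hypothesis a_neq : forall i n, (i.+1 < n)%N -> a i != a n.
Hypothesis b_neq : forall i n, (i.+1 < n)%N -> b i != b n.
Hypothesis cross_neq : forall i j n, (i < j)%N -> (j.+1 < n)%N ->
  (a i - a n) * (b j - b n) != (a j - a n) * (b i - b n).

(** The last line carries [n] distinct zeros of [p]: the point on y = 0 and the
    intersections with all the earlier lines but its predecessor.  At such an
    intersection tangency to two lines of different slopes forces p = 0. *)
Lemma restriction_eq0 n p q :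
    tdeg_lt n p -> map_poly (horner_eval 0) p = 0 ->
    (forall k, (k <= n)%N -> q.[aff_line k] = b k *: p.[aff_line k]) ->
  p.[aff_line n] = 0.
Proof.
move=> hp p0 hq; apply/eqP; apply: contraT => nz.
pose y i := (a i - a n) / (b n - b i).
pose rs := 0 :: [seq y i | i <- iota 0 n.-1].
have : (size rs < size (p.[aff_line n])%R)%N.
  apply: max_poly_roots => //.
    rewrite /rs /= {1}/root -[_.[0]]/(horner_eval 0 _) -horner_map p0 horner0 eqxx /=.
    apply/allP=> z /mapP[i]; rewrite mem_iota add0n => /andP[_ hi] {z}->.
    rewrite /root.
    have bn : b n - b i != 0 by rewrite subr_eq0 eq_sym b_neq //; lia.
    have E : (aff_line i).[y i] = (aff_line n).[y i].
      rewrite /aff_line !(hornerD, hornerZ, hornerC, hornerX) /y; field; exact: bn.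
    have ev k : (k <= n)%N -> q.[aff_line k].[y i] = b k * p.[aff_line k].[y i].
      by move=> hk; rewrite hq // hornerZ.
    have ee r : r.[aff_line i].[y i] = r.[aff_line n].[y i].
      by rewrite -![_.[y i]]/(horner_eval (y i) _) -!horner_map /= /horner_eval E.
    have := ev i ltac:(lia); rewrite ee ev // ee => /eqP.
    by rewrite -subr_eq0 -mulrBl mulf_eq0 (negbTE bn).
  rewrite /rs /=; apply/andP; split.
    apply/mapP=> -[i]; rewrite mem_iota add0n => /andP[_ hi] /esym /eqP.
    rewrite /y mulf_eq0 invr_eq0 !subr_eq0 (negbTE (a_neq _)) /=; last by lia.
    by rewrite eq_sym (negbTE (b_neq _)) //; lia.
  apply/(uniqP 0) => i j; rewrite !inE size_map size_iota => hi hj.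
  rewrite !(nth_map 0%N) ?size_iota // !nth_iota // !add0n.
  (* equal abscissas would make three lines concurrent *)
  wlog lt_ij : i j hi hj / (i < j)%N.
    move=> W; case: (ltngtP i j) => // h; first exact: W.
    by move/esym=> E; apply/esym; apply: W.
  move=> /eqP; rewrite /y eqr_div; last 2 first.
  - by rewrite subr_eq0 eq_sym b_neq //; lia.
  - by rewrite subr_eq0 eq_sym b_neq //; lia.
  rewrite -[b n - b j]opprB -[b n - b i]opprB !mulrN eqr_opp.
  by rewrite (negbTE (cross_neq lt_ij _)) //; lia.
have := tdeg_lt_horner hp (size_aff_line n).
rewrite /rs /= size_map size_iota; case: n {nz rs hp hq y} => [|n] /=; lia.
Qed.

(** Once the field vanishes on the last line it is divisible by the equation of
    that line, and the quotient is tangent to the remaining ones because the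
    lines are distinct. *)
Lemma tangent_eq0 n p q :
    tdeg_lt n.-1 p -> tdeg_lt n.-1 q -> map_poly (horner_eval 0) p = 0 ->
    (forall k, (k < n)%N -> q.[aff_line k] = b k *: p.[aff_line k]) ->
  p = 0 /\ q = 0.
Proof.
elim: n p q => [|n IH] p q /= hp hq p0 tang; first by split; apply: tdeg_lt0.
case: n => [|n] in IH hp hq tang *; first by split; apply: tdeg_lt0.
have pn := restriction_eq0 hp p0 tang.
have qn : q.[aff_line n.+1] = 0 by rewrite tang // pn scaler0.
have /factor_theorem[p1 Ep] : root p (aff_line n.+1) by apply/eqP.
have /factor_theorem[q1 Eq] : root q (aff_line n.+1) by apply/eqP.
have [] := IH p1 q1.
- by apply: (@tdeg_lt_factor _ _ (aff_line n.+1)); rewrite ?size_aff_line // -Ep.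
- by apply: (@tdeg_lt_factor _ _ (aff_line n.+1)); rewrite ?size_aff_line // -Eq.
- move: p0; rewrite Ep rmorphM /= => /eqP; rewrite mulf_eq0 => /orP[/eqP //|].
  by rewrite rmorphB /= map_polyX map_polyC /= polyXsubC_eq0.
- move=> k hk; have := tang k (ltnW hk).
  rewrite Ep Eq !hornerM hornerXsubC scalerAl => /mulIf -> //.
  by rewrite subr_eq0 line_inj.
by move=> p10 q10; rewrite Ep Eq p10 q10 !mul0r.
Qed.

End Descent.

(** * Affine charts of homogeneous polynomials *)

Lemma ord3_ind (P : 'I_3 -> Prop) :
  P ord3_0 -> P ord3_1 -> P ord3_2 -> forall k, P k.
Proof.
move=> P0 P1 P2 [[|[|[|//]]] hk].
- by rewrite (_ : Ordinal hk = ord3_0) //; apply: val_inj.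
- by rewrite (_ : Ordinal hk = ord3_1) //; apply: val_inj.
- by rewrite (_ : Ordinal hk = ord3_2) //; apply: val_inj.
Qed.

Lemma big_ord3 (R : Type) (idx : R) (op : Monoid.law idx) (F : 'I_3 -> R) :
  \big[op/idx]_(k < 3) F k = op (F ord3_0) (op (F ord3_1) (F ord3_2)).
Proof.
rewrite !big_ord_recl big_ord0 Monoid.mulm1.
by congr (op (F _) (op (F _) (F _))); apply: val_inj.
Qed.

Lemma mdeg3 (m : 'X_{1..3}) : mdeg m = (m ord3_0 + (m ord3_1 + m ord3_2))%N.
Proof. by rewrite mdegE big_ord3. Qed.

Definition mnm3 (i j k : nat) : 'X_{1..3} := [multinom nth 0%N [:: i; j; k] l | l < 3].

Lemma mnm3E (m : 'X_{1..3}) : m = mnm3 (m ord3_0) (m ord3_1) (m ord3_2).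
Proof. by apply/mnmP; elim/ord3_ind; rewrite mnmE. Qed.

Section Chart.
Variable K : fieldType.
Local Notation S := {mpoly K[3]}.
Implicit Types (p q : S) (t : K).

(** Substitution of [t] for x, with values in K[y][z].  The chart at t = 1
    dehomogenizes, the one at t = 0 restricts to the line x = 0; treating both
    at once makes their coefficients comparable.  It is a bundled morphism so
    that the morphism rules rewrite it quickly. *)
Definition chart t : {rmorphism S -> {poly {poly K}}} :=
  mmap (polyC \o polyC) (fun i : 'I_3 => [:: t%:P%:P; 'X%:P; 'X]`_i).

Lemma chartE t p : chart t p =
  mmap (polyC \o polyC) (fun i : 'I_3 => [:: t%:P%:P; 'X%:P; 'X]`_i) p.
Proof. by []. Qed.

Arguments chart t : simpl never.

Lemma chart_vx t : chart t (vx K) = t%:P%:P.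
Proof. by rewrite chartE mmapX mmap1U. Qed.
Lemma chart_vy t : chart t (vy K) = 'X%:P.
Proof. by rewrite chartE mmapX mmap1U. Qed.
Lemma chart_vz t : chart t (vz K) = 'X.
Proof. by rewrite chartE mmapX mmap1U. Qed.
Lemma chartZ t c p : chart t (c *: p) = c%:P%:P * chart t p.
Proof. by rewrite chartE mmapZ. Qed.

Lemma coef_chart t p i j : (chart t p)`_j`_i =
  \sum_(m <- msupp p | (m ord3_1 == i) && (m ord3_2 == j)) p@_m * t ^+ m ord3_0.
Proof.
rewrite chartE /mmap !coef_sum [RHS]big_mkcond; apply: eq_bigr => m _ /=.
rewrite /mmap1 big_ord3 /= -!polyC_exp !coefCM coefXn [j == _]eq_sym.
case: (m ord3_2 == j); last by rewrite andbF mulr0 coef0 !mulr0.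
by rewrite andbT mulr1 coefXn [i == _]eq_sym; case: (_ == _); rewrite ?mulr1 ?mulr0.
Qed.

Lemma coef_chart_homog s p t i j : p \is s.-homog -> (i + j <= s)%N ->
  (chart t p)`_j`_i = p@_(mnm3 (s - i - j) i j) * t ^+ (s - i - j).
Proof.
move=> hp hij; rewrite coef_chart; set M := mnm3 _ _ _.
have M0 : M ord3_0 = (s - i - j)%N by rewrite mnmE.
have M1 : M ord3_1 = i by rewrite mnmE.
have M2 : M ord3_2 = j by rewrite mnmE.
rewrite big_mkcond /=.
rewrite (eq_big_seq (fun m => if m == M then p@_M * t ^+ (s - i - j) else 0)); last first.
  move=> m hm /=; have : mdeg m = s := dhomog_mf hp hm.
  rewrite mdeg3 => dm; case: ifP => [/andP[/eqP m1 /eqP m2]|].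
    suff -> : m = M by rewrite eqxx M0.
    rewrite [m]mnm3E; congr mnm3 => //; lia.
  by case: (m =P M) => [->|//]; rewrite M1 M2 !eqxx.
have [Ms|Ms] := boolP (M \in msupp p).
  by rewrite (bigD1_seq M) ?msupp_uniq //= eqxx big1 ?addr0 // => m /negPf ->.
by rewrite (memN_msupp_eq0 Ms) mul0r big1 // => m _; case: ifP.
Qed.

Lemma coef_chart_homog_gt s p t i j : p \is s.-homog -> (s < i + j)%N ->
  (chart t p)`_j`_i = 0.
Proof.
move=> hp hij; rewrite coef_chart big_seq_cond big1 // => m /and3P[hm /eqP m1 /eqP m2].
have : mdeg m = s := dhomog_mf hp hm.
rewrite mdeg3; lia.
Qed.

Lemma chart1_inj s p : p \is s.-homog -> chart 1 p = 0 -> p = 0.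
Proof.
move=> hp p0; apply/mpolyP => m; rewrite mcoeff0.
have [dm|dm] := eqVneq (mdeg m) s; last exact: (dhomog_nemf_coeff hp).
move: (dm); rewrite mdeg3 => ds.
have := @coef_chart_homog s p 1 (m ord3_1) (m ord3_2) hp ltac:(lia).
rewrite p0 !coef0 expr1n mulr1.
by rewrite (_ : (s - _ - _)%N = m ord3_0) -?mnm3E //; lia.
Qed.

Lemma tdeg_ltP k (p : {poly {poly K}}) :
  (forall i j, (k <= i + j)%N -> p`_j`_i = 0) -> tdeg_lt k p.
Proof.
by move=> h j; apply/leq_sizeP => i hi; apply: h; lia.
Qed.

(** A form divisible by x loses one degree when x is set to 1: its top
    coefficients in the chart are those of its restriction to x = 0. *)
Lemma coef_chart1_top s p i j : p \is s.-homog -> chart 0 p = 0 ->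
  (s <= i + j)%N -> (chart 1 p)`_j`_i = 0.
Proof.
move=> hp p0; rewrite leq_eqVlt => /orP[/eqP e|lt]; last exact: (coef_chart_homog_gt _ hp).
have := @coef_chart_homog s p 0 i j hp; rewrite p0 !coef0 e leqnn => /(_ isT).
rewrite (coef_chart_homog _ hp) ?e //.
have -> : (i + j - i - j = 0)%N by lia.
by rewrite !expr0.
Qed.

End Chart.

Arguments chart {K} t : simpl never.

(** * Derivations killing a product of lines *)

Section Derivation.
Variable K : fieldType.
Local Notation S := {mpoly K[3]}.
Implicit Types (f g a b c : S).

Definition derivation a b c f : S :=
  a * f^`M(ord3_0) + b * f^`M(ord3_1) + c * f^`M(ord3_2).

Lemma derivationM a b c f g :
  derivation a b c (f * g) = derivation a b c f * g + f * derivation a b c g.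
Proof. by rewrite /derivation !mderivM; ring. Qed.

Lemma derivation_line a b c (u v w : K) :
  derivation a b c (u *: vx K + v *: vy K + w *: vz K) = u *: a + v *: b + w *: c.
Proof.
have dX i j : ('X_i : S)^`M(j) = (i == j)%:R.
  rewrite mderivX mnm1E; case: eqP => [->|_]; last by rewrite scale0r.
  rewrite scale1r (_ : (U_(j) - U_(j))%MM = 0%MM) ?mpolyX0 //.
  by apply/mnmP => k; rewrite mnmBE mnm0E subnn.
rewrite /derivation !mderivD !mderivZ /vx /vy /vz !dX /=.
by rewrite -!mul_mpolyC; ring.
Qed.

Lemma derivation_vx a b c : derivation a b c (vx K) = a.
Proof.
have := derivation_line a b c 1 0 0.
by rewrite !scale1r !scale0r !addr0.
Qed.

Lemma derivation_vy a b c : derivation a b c (vy K) = b.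
Proof.
have := derivation_line a b c 0 1 0.
by rewrite !scale1r !scale0r !addr0 !add0r.
Qed.

Lemma euler_prod (I : Type) (r : seq I) (F : I -> S) :
  (forall i, derivation (vx K) (vy K) (vz K) (F i) = F i) ->
  derivation (vx K) (vy K) (vz K) (\prod_(i <- r) F i)
    = (size r)%:R *: \prod_(i <- r) F i.
Proof.
move=> hF; elim: r => [|i r IH].
  by rewrite big_nil scale0r /derivation -mpolyC1 !mderivC !mulr0 !addr0.
rewrite big_cons derivationM hF IH /= mulrS scalerDl scale1r; congr (_ + _).
by rewrite scalerAr.
Qed.

(** A derivation killing l g is tangent to l = 0 wherever [g] does not vanish
    identically; [psi] is the restriction to l = 0. *)
Lemma tangent_line (R : idomainType) (psi : {rmorphism S -> R}) a b c l g :
  derivation a b c (l * g) = 0 -> psi l = 0 -> psi g != 0 ->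
  psi (derivation a b c l) = 0.
Proof.
rewrite derivationM => /(congr1 psi); rewrite rmorphD !rmorphM rmorph0 => + l0 g0.
by rewrite l0 mul0r addr0 => /eqP; rewrite mulf_eq0 (negbTE g0) orbF => /eqP.
Qed.

End Derivation.

Section LowerBound.
Variable K : fieldType.
Variables a b : nat -> K.
Local Notation S := {mpoly K[3]}.
Variable n : nat.

Definition proj_line k : S := a k *: vx K + b k *: vy K - vz K.
Definition line_product : S := vx K * vy K * \prod_(k <- iota 0 n) proj_line k.

Lemma derivation_proj_line u v w k : derivation u v w (proj_line k) = a k *: u + b k *: v - w.
Proof. by have := derivation_line u v w (a k) (b k) (-1); rewrite !scaleN1r. Qed.

Lemma chart_proj_line t k :
  chart t (proj_line k) = ((a k * t)%:P + b k *: 'X)%:P - 'X.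
Proof.
rewrite /proj_line rmorphB rmorphD /= !chartZ chart_vx chart_vy chart_vz.
by rewrite -mul_polyC polyCD !polyCM.
Qed.

Lemma euler_line_product :
  derivation (vx K) (vy K) (vz K) line_product = n.+2%:R *: line_product.
Proof.
rewrite /line_product !derivationM derivation_vx derivation_vy euler_prod ?size_iota.
  by rewrite -(addn2 n) natrD scalerDl -scalerAr (scaler_nat 2); ring.
by move=> k; rewrite derivation_proj_line.
Qed.

Hypothesis line_inj : forall i n, (i < n)%N -> aff_line a b i != aff_line a b n.
Hypothesis a_neq : forall i n, (i.+1 < n)%N -> a i != a n.
Hypothesis b_neq : forall i n, (i.+1 < n)%N -> b i != b n.
Hypothesis cross_neq : forall i j n, (i < j)%N -> (j.+1 < n)%N ->
  (a i - a n) * (b j - b n) != (a j - a n) * (b i - b n).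
Hypothesis pchar0 : [pchar K] =i pred0.

Lemma chart_proj_line_neq0 t k : chart t (proj_line k) != 0.
Proof. by rewrite chart_proj_line -oppr_eq0 opprB polyXsubC_eq0. Qed.

Lemma chart_line_product_neq0 : chart 1 line_product != 0.
Proof.
rewrite /line_product !rmorphM /= chart_vx chart_vy rmorph_prod /=.
rewrite !mulf_neq0 ?polyC_eq0 ?oner_eq0 ?polyX_eq0 //.
by rewrite prodf_seq_neq0; apply/allP => k _; apply: chart_proj_line_neq0.
Qed.

Lemma lines_neq i j : i != j -> aff_line a b i != aff_line a b j.
Proof.
rewrite neq_ltn => /orP[] h; first exact: line_inj.
by rewrite eq_sym line_inj.
Qed.

Variables (s : nat) (u v w : S).
Hypothesis hs : (s.+1 < n)%N.
Hypothesis hu : u \is s.-homog.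
Hypothesis hv : v \is s.-homog.
Hypothesis hw : w \is s.-homog.
Hypothesis syz : derivation u v w line_product = 0.

Lemma syzygy_at_x0 : chart 0 u = 0.
Proof.
rewrite -(derivation_vx u v w).
apply: (@tangent_line K _ (chart 0) u v w _ (vy K * \prod_(k <- iota 0 n) proj_line k)).
- by rewrite mulrA.
- by rewrite /= chart_vx.
rewrite rmorphM /= chart_vy rmorph_prod /= mulf_neq0 ?polyC_eq0 ?polyX_eq0 //.
by rewrite prodf_seq_neq0; apply/allP => k _; apply: chart_proj_line_neq0.
Qed.

Lemma syzygy_at_y0 : map_poly (horner_eval 0) (chart 1 v) = 0.
Proof.
rewrite -(derivation_vy u v w).
apply: (@tangent_line K _ (map_poly (horner_eval 0) \o chart 1) u v w _
  (vx K * \prod_(k <- iota 0 n) proj_line k)).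
- by rewrite mulrA [vy K * _]mulrC.
- by rewrite /= chart_vy map_polyC /= /horner_eval hornerX.
rewrite rmorphM rmorph_prod; apply: mulf_neq0.
  by rewrite /= chart_vx map_polyC /= /horner_eval hornerC !polyC_eq0 oner_eq0.
rewrite prodf_seq_neq0; apply/allP => k _ /=.
by rewrite chart_proj_line rmorphB /= map_polyC map_polyX -oppr_eq0 opprB polyXsubC_eq0.
Qed.

Lemma syzygy_on_line k : (k < n)%N ->
  a k *: (chart 1 u).[aff_line a b k] + b k *: (chart 1 v).[aff_line a b k]
  = (chart 1 w).[aff_line a b k].
Proof.
move=> hk; apply/eqP; rewrite -subr_eq0; apply/eqP.
have := derivation_proj_line u v w k => E.
pose psi : {rmorphism S -> {poly K}} := horner_eval (aff_line a b k) \o chart 1.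
have chart1 i : psi (proj_line i) = aff_line a b i - aff_line a b k.
  by rewrite /psi /= chart_proj_line mulr1 /horner_eval hornerD hornerN hornerX hornerC.
have := @tangent_line K _ psi u v w (proj_line k)
  (vx K * vy K * \prod_(i <- rem k (iota 0 n)) proj_line i).
rewrite E.
have mem_k : k \in iota 0 n by rewrite mem_iota add0n.
have -> : proj_line k * (vx K * vy K * \prod_(i <- rem k (iota 0 n)) proj_line i) = line_product.
  by rewrite /line_product [in RHS](big_rem k) //=; ring.
move=> /(_ syz); rewrite chart1 subrr => /(_ erefl).
have nz : psi (vx K * vy K * \prod_(i <- rem k (iota 0 n)) proj_line i) != 0.
  rewrite !rmorphM rmorph_prod; apply: mulf_neq0; first apply: mulf_neq0.
  - by rewrite /psi /= chart_vx /horner_eval hornerC oner_eq0.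
  - by rewrite /psi /= chart_vy /horner_eval hornerC polyX_eq0.
  rewrite prodf_seq_neq0; apply/allP => i hi; apply/implyP => _.
  rewrite chart1 subr_eq0 lines_neq //.
  by move: hi; rewrite mem_rem_uniq ?iota_uniq // !inE => /andP[].
move=> /(_ nz); rewrite /psi /= /horner_eval !rmorphD rmorphN /= !chartZ.
by rewrite !(hornerE) /= !mul_polyC.
Qed.

(** Modulo the Euler derivation the syzygy is an affine vector field to which
    [tangent_eq0] applies; a multiple of the Euler derivation kills a nonzero
    form only if it is zero, in characteristic zero. *)
Lemma no_small_syzygy : (u, v, w) = (0, 0, 0).
Proof.
set U := chart 1 u; set V := chart 1 v; set W := chart 1 w.
have topU i j : (s <= i + j)%N -> U`_j`_i = 0.
  by apply: coef_chart1_top => //; apply: syzygy_at_x0.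
have [] := @tangent_eq0 K a b line_inj a_neq b_neq cross_neq n
   (V - U * 'X%:P) (W - U * 'X).
- apply: tdeg_ltP => i j hij; rewrite !coefB coefMC coefMX.
  rewrite (@coef_chart_homog_gt _ s) // ?sub0r; last by lia.
  by case: i hij => [|i] hij /=; rewrite ?oppr0 // topU ?oppr0 //; lia.
- apply: tdeg_ltP => i j hij; rewrite !coefB coefMX.
  rewrite (@coef_chart_homog_gt _ s) // ?sub0r; last by lia.
  by case: j hij => [|j] hij /=; rewrite ?coef0 ?oppr0 // topU ?oppr0 //; lia.
- by rewrite rmorphB rmorphM /= syzygy_at_y0 map_polyC /= /horner_eval hornerX mulr0 subr0.
- move=> k hk; rewrite !(hornerD, hornerN, hornerM, hornerX, hornerC).
  rewrite -(syzygy_on_line hk) -/U -/V /aff_line -!mul_polyC; ring.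
move=> /eqP; rewrite subr_eq0 => /eqP EV /eqP; rewrite subr_eq0 => /eqP EW.
have U0 : U = 0.
  have := congr1 (chart 1) syz.
  rewrite /derivation !rmorphD !rmorphM rmorph0 /= -/U -/V -/W EV EW.
  have := congr1 (chart 1) euler_line_product.
  rewrite /derivation !rmorphD !rmorphM /= chartZ chart_vx chart_vy chart_vz.
  set fx := chart _ _; set fy := chart _ _; set fz := chart _ _ => e1 e2.
  have {}e2 : U * (n.+2%:R%:P%:P * chart 1 line_product) = 0.
    by rewrite -e1 -[RHS]e2; ring.
  move/eqP: e2; rewrite !mulf_eq0 !polyC_eq0 (negbTE chart_line_product_neq0).
  by move/pcharf0P: pchar0 => ->; rewrite !orbF => /eqP.
by congr (_, _, _); apply: (chart1_inj (s := s)) => //; rewrite -/V -/W ?EV ?EW U0 ?mul0r.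
Qed.

End LowerBound.

(** * The zigzag arrangement *)

Lemma mderiv_homog (n : nat) (R : nzRingType) s (p : {mpoly R[n]}) i :
  p \is s.+1.-homog -> p^`M(i) \is s.-homog.
Proof.
move=> hp; apply/dhomogP => m; rewrite mcoeff_msupp mcoeff_mderiv => nz.
have /(dhomog_mf hp) : (m + U_(i))%MM \in msupp p.
  by rewrite mcoeff_msupp; apply: contra_neq nz => ->; rewrite mul0rn.
by rewrite /= mdegD mdeg1 addn1 => -[].
Qed.

Section Homog.
Variable K : fieldType.
Local Notation S := {mpoly K[3]}.

Lemma prod_homog1 (I : Type) (r : seq I) (F : I -> S) :
  (forall i, F i \is 1.-homog) -> \prod_(i <- r) F i \is (size r).-homog.
Proof.
move=> hF; elim: r => [|i r IH]; first by rewrite big_nil dhomog1.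
by rewrite big_cons /= -(add1n (size r)); apply: dhomogM.
Qed.

Lemma variable_homog (i : 'I_3) : ('X_i : S) \is 1.-homog.
Proof. by rewrite dhomogX; apply/eqP; apply: mdeg1. Qed.
Lemma vx_homog : vx K \is 1.-homog. Proof. exact: variable_homog. Qed.
Lemma vy_homog : vy K \is 1.-homog. Proof. exact: variable_homog. Qed.
Lemma vz_homog : vz K \is 1.-homog. Proof. exact: variable_homog. Qed.

Lemma proj_line_homog (a b : nat -> K) k : proj_line a b k \is 1.-homog.
Proof.
by rewrite rpredB ?rpredD ?rpredZ ?vx_homog ?vy_homog ?vz_homog.
Qed.

(** Subtracting multiples of the Euler derivation is how a derivation is
    corrected to kill a given form. *)
Lemma derivation_sub_euler (a b c p q f : S) :
  derivation (p * a - q * vx K) (p * b - q * vy K) (p * c - q * vz K) f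
  = p * derivation a b c f - q * derivation (vx K) (vy K) (vz K) f.
Proof. by rewrite /derivation; ring. Qed.

End Homog.

Section Bd.
Variable K : fieldType.
Hypothesis pchar0 : [pchar K] =i pred0.
Local Notation S := {mpoly K[3]}.

Lemma natr_inj_pchar0 : injective (fun n : nat => n%:R : K).
Proof.
move=> m n; wlog le_mn : m n / (m <= n)%N.
  by move=> W; case: (leqP m n) => [|/ltnW] h E; [apply: W | apply/esym/W].
move=> /esym/eqP; rewrite -subr_eq0 -natrB //.
by move/pcharf0P: pchar0 => ->; lia.
Qed.

Lemma natrX_neq0 c k : (0 < c)%N -> (c%:R : K) ^+ k != 0.
Proof. by move=> c0; rewrite expf_neq0 //; move/pcharf0P: pchar0 => ->; rewrite -lt0n. Qed.

(** The indices run along the zigzag: line 2j has exponents (j+1, j+1) and line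
    2j+1 has exponents (j+1, j+2), so that the arrangements of even and odd size
    are initial segments of one sequence. *)
Definition xcoef k : K := 2 ^- k./2.+1.
Definition ycoef k : K := 3 ^- (uphalf k).+1.

Lemma exprV_sub c (i n : nat) : (0 < c)%N -> (i <= n)%N ->
  (c%:R ^- i - c%:R ^- n : K) = c%:R ^- n * (c ^ (n - i) - 1)%N%:R.
Proof.
move=> c0 le_in; rewrite natrB ?expn_gt0 ?c0 // natrX.
rewrite -{1 2}(subnK le_in) exprD.
have h1 := natrX_neq0 i c0; have h2 := natrX_neq0 (n - i) c0.
by field; rewrite h1 h2.
Qed.

Lemma xcoef_sub i n : (i <= n)%N -> xcoef i - xcoef n = xcoef n * (2 ^ (n./2 - i./2) - 1)%N%:R.
Proof.
by move=> h; rewrite /xcoef exprV_sub ?ltnS ?half_leq // subSS.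
Qed.

Lemma ycoef_sub i n : (i <= n)%N ->
  ycoef i - ycoef n = ycoef n * (3 ^ (uphalf n - uphalf i) - 1)%N%:R.
Proof.
by move=> h; rewrite /ycoef exprV_sub ?ltnS ?uphalf_leq // subSS.
Qed.

Lemma xcoef_neq0 k : xcoef k != 0. Proof. by rewrite invr_eq0 natrX_neq0. Qed.
Lemma ycoef_neq0 k : ycoef k != 0. Proof. by rewrite invr_eq0 natrX_neq0. Qed.

Lemma pow_sub1_neq0 c k : (1 < c)%N -> (0 < k)%N -> ((c ^ k - 1)%N%:R : K) != 0.
Proof.
move=> c1 k0; move/pcharf0P: pchar0 => ->.
by rewrite subn_eq0 -ltnNge -[X in (X < _)%N](expn0 c) ltn_exp2l.
Qed.

Lemma xcoef_neq i n : (i./2 < n./2)%N -> xcoef i != xcoef n.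
Proof.
move=> h; rewrite -subr_eq0 xcoef_sub; last by rewrite leqNgt; apply/negP => /ltnW/half_leq; lia.
by rewrite mulf_neq0 ?xcoef_neq0 ?pow_sub1_neq0 // subn_gt0.
Qed.

Lemma ycoef_neq i n : (uphalf i < uphalf n)%N -> ycoef i != ycoef n.
Proof.
move=> h; rewrite -subr_eq0 ycoef_sub; last by rewrite leqNgt; apply/negP => /ltnW/uphalf_leq; lia.
by rewrite mulf_neq0 ?ycoef_neq0 ?pow_sub1_neq0 // subn_gt0.
Qed.

(** The exponent gaps m = n/2 - i/2 and n' = (n+1)/2 - (i+1)/2 satisfy
    n' - m = odd n - odd i.  Concurrence forces equal parities of the gaps, hence
    of [i] and [j]; then the gaps of [i] exceed those of [j] by a common amount
    and monotonicity applies. *)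
Lemma cross_coef_neq i j n : (i < j)%N -> (j.+1 < n)%N ->
  (xcoef i - xcoef n) * (ycoef j - ycoef n) != (xcoef j - xcoef n) * (ycoef i - ycoef n).
Proof.
move=> hij hjn; rewrite !xcoef_sub ?ycoef_sub; try lia.
rewrite !mulrA ![_ * ycoef n]mulrAC -!(mulrA (xcoef n * ycoef n)) -!natrM.
rewrite (inj_eq (mulfI _)) ?mulf_neq0 ?xcoef_neq0 ?ycoef_neq0 // (inj_eq natr_inj_pchar0).
have m_i : (0 < n./2 - i./2)%N by lia.
have m_j : (0 < n./2 - j./2)%N by lia.
have n_i : (0 < uphalf n - uphalf i)%N by lia.
have n_j : (0 < uphalf n - uphalf j)%N by lia.
apply/eqP => E.
have [e1 e2] := cross_parity m_i n_i m_j n_j E.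
have [t t0 [tm tn]] : exists2 t, (0 < t)%N &
    (n./2 - i./2 = n./2 - j./2 + t)%N /\
    (uphalf n - uphalf i = uphalf n - uphalf j + t)%N.
  by exists (j - i)./2; move: E e1 e2 => _; lia.
by have := cross_mono (uphalf n - uphalf j) m_j t0; rewrite -tm -tn E ltnn.
Qed.

Lemma coef_line_inj i n : (i < n)%N -> aff_line xcoef ycoef i != aff_line xcoef ycoef n.
Proof.
move=> h; apply/eqP => E.
have ea : xcoef i = xcoef n.
  by have := congr1 (fun p : {poly K} => p`_0) E; rewrite !coefD !coefC !coefZ !coefX !mulr0 !addr0.
have eb : ycoef i = ycoef n.
  by have := congr1 (fun p : {poly K} => p`_1) E; rewrite !coefD !coefC !coefZ !coefX !mulr1 !add0r.
have [h1|h1] : (i./2 < n./2)%N \/ (uphalf i < uphalf n)%N by lia.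
  by move/eqP: (xcoef_neq h1).
by move/eqP: (ycoef_neq h1).
Qed.

Lemma prod_iotaS n (F : nat -> S) :
  \prod_(k <- iota 0 n.+1) F k = \prod_(k <- iota 0 n) F k * F n.
Proof. by rewrite -(addn1 n) iotaD big_cat big_seq1. Qed.

Lemma B_evenE p : B_even K p.+1 = line_product xcoef ycoef p.*2.
Proof.
rewrite /B_even /line_product; congr (_ * _).
elim: p => [|p IH]; first by rewrite big_geq // big_nil.
rewrite big_nat_recr // IH doubleS !prod_iotaS -mulrA /proj_line /xcoef /ycoef /Bline.
by rewrite /= !uphalf_double doubleK.
Qed.

Lemma BE d : (2 <= d)%N -> B K d = line_product xcoef ycoef (d - 2).
Proof.
move=> hd; rewrite /B.
have [q Eq] : exists q, d./2 = q.+1 by exists (d./2).-1; lia.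
case: ifP => od; rewrite Eq; last first.
  by rewrite B_evenE; congr line_product; lia.
have -> : (d - 2 = q.*2.+1)%N by lia.
have := B_evenE q; rewrite /B_even /line_product prod_iotaS /B_odd.
have -> : proj_line xcoef ycoef q.*2 = Bline K q.+1 q.+1.
  by rewrite /proj_line /xcoef /ycoef /Bline doubleK uphalf_double.
by rewrite mulrA => <-; rewrite mulrAC.
Qed.

(** Evaluation at the coordinate vectors reads off the coefficients of a linear
    form. *)
Lemma zigzag_line_arrangement n : line_arrangement n.+2 (line_product xcoef ycoef n).
Proof.
pose l (i : nat) : S :=
  if i is k.+2 then proj_line xcoef ycoef k else if i is 1 then vy K else vx K.
pose e (k : 'I_3) (i : 'I_3) : K := (i == k)%:R.
have evx k : (vx K).@[e k] = (ord3_0 == k)%:R by rewrite mevalXU.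
have evy k : (vy K).@[e k] = (ord3_1 == k)%:R by rewrite mevalXU.
have evz k : (vz K).@[e k] = (ord3_2 == k)%:R by rewrite mevalXU.
have evl k i : (proj_line xcoef ycoef i).@[e k] =
    xcoef i * (ord3_0 == k)%:R + ycoef i * (ord3_1 == k)%:R - (ord3_2 == k)%:R.
  by rewrite /proj_line mevalB mevalD !mevalZ evx evy evz.
pose ev := (evx, evy, evz, evl).
exists (fun i => l i); split.
- move=> [[|[|k]] hk] /=.
  + rewrite vx_homog; split=> //; apply/eqP => /(congr1 (meval (e ord3_0))).
    by rewrite evx meval0 => /eqP; rewrite oner_eq0.
  + rewrite vy_homog; split=> //; apply/eqP => /(congr1 (meval (e ord3_1))).
    by rewrite evy meval0 => /eqP; rewrite oner_eq0.
  rewrite proj_line_homog; split=> //; apply/eqP => /(congr1 (meval (e ord3_0))).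
  by rewrite evl meval0 /= mulr1 mulr0 addr0 subr0 => /eqP; rewrite (negbTE (xcoef_neq0 _)).
- have coord c p q k : p = c *: q -> p.@[e k] = c * q.@[e k] by move->; rewrite mevalZ.
  have contra0 c p q k k' : p.@[e k] = 0 -> q.@[e k] != 0 -> p.@[e k'] != 0 -> p <> c *: q.
    move=> p0 q0 p1 E; have /esym/eqP := coord _ _ _ k E.
    rewrite p0 mulf_eq0 (negbTE q0) orbF => /eqP c0.
    by move: p1; rewrite (coord _ _ _ k' E) c0 mul0r eqxx.
  move=> [[|[|i]] hi] [[|[|j]] hj] ne c //=; apply/eqP.
  + by apply: (contra0 _ _ _ ord3_1 ord3_0); rewrite !ev //= oner_eq0.
  + by apply: (contra0 _ _ _ ord3_2 ord3_0);
      rewrite !ev //= ?mulr0 ?addr0 ?sub0r ?oppr_eq0 oner_eq0.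
  + by apply: (contra0 _ _ _ ord3_0 ord3_1); rewrite !ev //= oner_eq0.
  + by apply: (contra0 _ _ _ ord3_2 ord3_1);
      rewrite !ev //= ?mulr0 ?addr0 ?sub0r ?oppr_eq0 oner_eq0.
  + move=> /(coord _ _ _ ord3_2); rewrite !ev /= !mulr0 !addr0 sub0r => /eqP.
    by rewrite oppr_eq0 oner_eq0.
  + move=> /(coord _ _ _ ord3_2); rewrite !ev /= !mulr0 !addr0 sub0r => /eqP.
    by rewrite oppr_eq0 oner_eq0.
  move=> E; have := coord _ _ _ ord3_2 E; rewrite !ev /= !mulr0 !addr0 sub0r mulrN1.
  move/oppr_inj => c1; move: E; rewrite -c1 scale1r => E.
  have ij : i != j by apply: contra_neq ne => ij; apply: val_inj; rewrite /= ij.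
  have := lines_neq coef_line_inj ij; rewrite /aff_line => /eqP; apply.
  have := congr1 (meval (e ord3_0)) E; have := congr1 (meval (e ord3_1)) E.
  by rewrite !ev /= !mulr0 !mulr1 !add0r !subr0 !addr0 => -> ->.
rewrite big_ord_recl big_ord_recl /= mulrA /line_product; congr (_ * _).
by rewrite -(big_mkord xpredT (fun k => proj_line xcoef ycoef k)) /index_iota subn0.
Qed.

(** The direction of the triple point (2 : 0 : 1) of y, L_0 and L_1 gives a
    constant derivation killing these three factors.  The syzygy is nonzero: its
    second component is - D(h) y, and if D(h) = 0 its first one is a nonzero
    multiple of h. *)
Lemma zigzag_syzygy n : (2 <= n)%N -> has_jacobian_syzygy (line_product xcoef ycoef n) n.-1.
Proof.
case: n => [|[|n]] // _ /=.
pose g : S := vy K * (proj_line xcoef ycoef 0 * proj_line xcoef ycoef 1).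
pose h : S := vx K * \prod_(k <- iota 2 n) proj_line xcoef ycoef k.
have fE : line_product xcoef ycoef n.+2 = g * h.
  by rewrite /line_product /= !big_cons /g /h; ring.
pose D := derivation (2%:R : S) 0 1.
have D_proj_line k : (k < 2)%N -> D (proj_line xcoef ycoef k) = 0.
  move=> hk; rewrite /D derivation_proj_line scaler0 addr0 /xcoef.
  have -> : k./2 = 0%N by lia.
  rewrite expr1 -scaler_nat scalerA mulVf ?scale1r ?subrr //.
  by move/pcharf0P: pchar0 => ->.
have Dg : D g = 0.
  by rewrite /D !derivationM derivation_vy -!/(D _) !D_proj_line // !(mul0r, mulr0, addr0).
have h_homog : h \is n.+1.-homog.
  rewrite -(add1n n) /h; apply: dhomogM; first exact: vx_homog.
  by rewrite -{2}(size_iota 2 n); apply: prod_homog1 => k; apply: proj_line_homog.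
have Dh_homog : D h \is n.-homog.
  rewrite /D /derivation mul0r addr0 mul1r mulr_natl.
  by rewrite rpredD ?rpredMn ?mderiv_homog.
pose N : K := n.+4%:R.
have N0 : N != 0 by move/pcharf0P: pchar0 => ->.
have comp_homog (c : K) (v : S) : v \is 1.-homog -> (N *: h) * c%:MP - D h * v \is n.+1.-homog.
  move=> hv; rewrite mulrC mul_mpolyC rpredB ?rpredZ //.
  by rewrite -(addn1 n); apply: dhomogM.
exists ((N *: h) * 2%:R%:MP - D h * vx K),
  ((N *: h) * 0%:MP - D h * vy K),
  ((N *: h) * 1%:MP - D h * vz K).
split.
- by rewrite !comp_homog ?vx_homog ?vy_homog ?vz_homog.
- apply/negP => /eqP E.
  have E1 : (N *: h) * 2%:R%:MP - D h * vx K = 0 := congr1 (fun z => z.1.1) E.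
  have /eqP : (N *: h) * 0%:MP - D h * vy K = 0 := congr1 (fun z => z.1.2) E.
  rewrite mpolyC0 mulr0 sub0r.
  rewrite oppr_eq0 mulf_eq0 => /orP[/eqP Dh0|]; last first.
    move=> /eqP /(congr1 (chart 1)); rewrite chart_vy rmorph0 => /eqP.
    by rewrite polyC_eq0 polyX_eq0.
  move: E1; rewrite Dh0 mul0r subr0 => /eqP.
  rewrite mulf_eq0 scaler_eq0 (negbTE N0) mpolyC_eq0 /=.
  have -> : (2%:R == 0 :> K) = false by move/pcharf0P: pchar0 => ->.
  rewrite orbF => /eqP h0.
  have := chart_line_product_neq0 xcoef ycoef n.+2; rewrite fE h0 mulr0 rmorph0 eqxx //.
rewrite -/(derivation _ _ _ _) derivation_sub_euler euler_line_product fE.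
have -> : derivation 2%:R%:MP 0%:MP 1%:MP (g * h) = g * D h.
  rewrite mpolyC_nat mpolyC0 mpolyC1 -/D /D derivationM -!/(D _) Dg mul0r add0r.
  by [].
by rewrite -!mul_mpolyC; ring.
Qed.

End Bd.

Theorem theorem4p11 (K : fieldType) (charK0 : [pchar K] =i pred0)
    (d : nat) (hd : (7 <= d)%N) :
  line_arrangement d (B K d) /\ is_mdr (B K d) (d - 3).
Proof.
rewrite BE; last by lia.
have -> : (d - 3 = (d - 2).-1)%N by lia.
split.
  by have := zigzag_line_arrangement charK0 (d - 2); rewrite (_ : (d - 2).+2 = d) //; lia.
split; first by apply: zigzag_syzygy => //; lia.
move=> s [u [v [w [[hu hv hw] nz syz]]]]; rewrite leqNgt; apply/negP => hs.
move/eqP: nz; apply.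
apply: (@no_small_syzygy K (xcoef K) (ycoef K) (d - 2)) hu hv hw syz => //.
- exact: coef_line_inj.
- by move=> i n hin; apply: xcoef_neq => //; lia.
- by move=> i n hin; apply: ycoef_neq => //; lia.
- exact: cross_coef_neq.
lia.
Qed.
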